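(* Let $k\ge2$ and let $\Sigma^{(k)}$ be the set of $(k+1)$-nonnesting open permutation diagrams. To each $\sigma\in\Sigma^{(k)}$ associate the label $[h;\mathbf r;\mathbf s]=[h;r_1,\dots,r_{k-1};s_1,\dots,s_{k-1}]$, where $2h$ is the number of semi-arcs, $r_i$ is the number of upper semi-arcs with enhanced nesting index $\ge i$, and $s_i$ is the number of lower semi-arcs with nesting index $\ge i$; set $r_0=s_0=h$, and write $\mathbf r-1=(r_1-1,\dots,r_{k-1}-1)$, $\mathbf s-1=(s_1-1,\dots,s_{k-1}-1)$. Write $R_{j,i}=(r_1-1,\dots,r_{j-1}-1,i,r_{j+1},\dots,r_{k-1})$ and $S_{\jmath,\imath}=(s_1-1,\dots,s_{\jmath-1}-1,\imath,s_{\jmath+1},\dots,s_{k-1})$, and let $I_r$ be the set of pairs $(j,i)$ with $1\le j\le k-1$, $r_j\le i\le r_{j-1}-1$, and $I_s$ the set of pairs $(\jmath,\imath)$ with $1\le\jmath\le k-1$, $s_\jmath\le\imath\le s_{\jmath-1}-1$. Consider the generating tree with root label $[0;\mathbf 0;\mathbf 0]$ and succession rule sending $[h;\mathbf r;\mathbf s]$ to: (1) $[h;h,r_2,\dots,r_{k-1};\mathbf s]$; (2) $[h+1;\mathbf r;\mathbf s]$; (3a) $[h;\mathbf r-1;\mathbf s]$ if $r_{k-1}\ge1$; (3b) $[h;R_{j,i};\mathbf s]$ for each $(j,i)\in I_r$; (4a) $[h;\mathbf r;\mathbf s-1]$ if $s_{k-1}\ge1$; (4b) $[h;\mathbf r;S_{\jmath,\imath}]$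 for each $(\jmath,\imath)\in I_s$; (5a) $[h-1;\mathbf r-1;\mathbf s-1]$ if $r_{k-1}\ge1$ and $s_{k-1}\ge1$; (5b) $[h-1;\mathbf r-1;S_{\jmath,\imath}]$, if $r_{k-1}\ge1$, for each $(\jmath,\imath)\in I_s$; (5c) $[h-1;R_{j,i};\mathbf s-1]$, if $s_{k-1}\ge1$, for each $(j,i)\in I_r$; (5d) $[h-1;R_{j,i};S_{\jmath,\imath}]$ for each $(j,i)\in I_r$ and $(\jmath,\imath)\in I_s$. Then for every $n\ge0$ the number of diagrams in $\Sigma^{(k)}$ of size $n$ equals the number of nodes at level $n$ of this generating tree.
   Context: An open permutation diagram of size $n\ge0$ consists of vertices $1,\dots,n$ in a row together with upper arcs $(a,b)$, $a<b$, upper semi-arcs $(a,* )$ (left end-point only), lower arcs $(a,b)$, $a<b$, and lower semi-arcs $(a,* )$, such that each vertex is of one of the types: fixed point (incident to nothing); opener (left end-point of exactly one upper arc or upper semi-arc and exactly one lower arc or lower semi-arc, nothing else); closer (right end-point of exactly one upper arc and one lower arc, nothing else); upper transitory (right end-point of one upper arc and left end-point of one upper arc or upper semi-arc, nothing else); lower transitory (same with lower). Upper and lower semi-arcs are equinumerous. An upper (resp. lower) $k$-nesting is a set of $k$ upper (resp. lower) arcs $(i_1,j_1),\dots,(i_k,j_k)$ with $i_1<\dots<i_k<j_k<\dots<j_1$. An upper enhanced $k$-nesting is an upper $k$-nesting, or $k-1$ upper arcs $(i_1,j_1),\dots,(i_{k-1},j_{k-1})$ and a fixed point $i_k$ with $i_1<\dots<i_{k-1}<i_k<j_{k-1}<\dots<j_1$.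 A future enhanced upper $k$-nesting is an upper enhanced $(k-1)$-nesting together with an upper semi-arc whose left end-point is smaller than all its vertices; a future lower $k$-nesting is a lower $(k-1)$-nesting with a lower semi-arc whose left end-point is smaller than all its vertices. The enhanced nesting index of an upper semi-arc is the largest $j\ge0$ such that it belongs to a future enhanced upper $(j+1)$-nesting; the nesting index of a lower semi-arc is the largest $j\ge0$ such that it belongs to a future lower $(j+1)$-nesting. An open permutation diagram is $k$-nonnesting if it contains no upper enhanced $k$-nesting, no future enhanced upper $k$-nesting, no lower $k$-nesting and no future lower $k$-nesting. A generating tree with root label $L_0$ and a succession rule (assigning to each label a finite list of labels, with multiplicity) is the rooted tree whose root, at level $0$, has label $L_0$, and in which each node with label $L$ has one child for each entry of the list assigned to $L$, labelled by that entry; level $n$ consists of the nodes at distance $n$ from the root. *)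

(* Defs.v *)
From mathcomp Require Import all_boot.

Set Implicit Arguments.
Unset Strict Implicit.
Unset Printing Implicit Defensive.

Section Diagrams.

Variable n : nat.

(* The vertices 1, ..., n are represented by the elements of 'I_n. *)
Definition arc := ('I_n * 'I_n)%type.

(* The arcs and the left end-points of the semi-arcs on one side of the row.
   A semi-arc (a,* ) is determined by a, and so is represented by a. *)
Definition side := ({set arc} * {set 'I_n})%type.

(* Upper side and lower side; [is_open_diagram] below carves the open
   permutation diagrams out of this finite type. *)
Definition diagram := (side * side)%type.

Definition arcs (H : side) : {set arc} := H.1.
Definition semiarcs (H : side) : {set 'I_n} := H.2.
Definition upper (d : diagram) : side := d.1.
Definition lower (d : diagram) : side := d.2.

Definition lefts (H : side) (v : 'I_n) : nat :=
  #|[set e in arcs H | e.1 == v]| + (v \in semiarcs H).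
Definition rights (H : side) (v : 'I_n) : nat :=
  #|[set e in arcs H | e.2 == v]|.

Definition incidence (d : diagram) (v : 'I_n) : (nat * nat) * (nat * nat) :=
  ((lefts (upper d) v, rights (upper d) v),
   (lefts (lower d) v, rights (lower d) v)).

Definition is_fixed d v := incidence d v == ((0, 0), (0, 0)).
Definition is_opener d v := incidence d v == ((1, 0), (1, 0)).
Definition is_closer d v := incidence d v == ((0, 1), (0, 1)).
Definition is_upper_transitory d v := incidence d v == ((1, 1), (0, 0)).
Definition is_lower_transitory d v := incidence d v == ((0, 0), (1, 1)).

Definition is_open_diagram (d : diagram) : bool :=
  [&& [forall e in arcs (upper d), e.1 < e.2],
      [forall e in arcs (lower d), e.1 < e.2],
      [forall v, [|| is_fixed d v, is_opener d v, is_closer d v,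
                     is_upper_transitory d v | is_lower_transitory d v]]
    & #|semiarcs (upper d)| == #|semiarcs (lower d)|].

(* i_1, ..., i_m, f, j_m, ..., j_1 for the arcs t = (i_1,j_1), ..., (i_m,j_m)
   and an optional point f. *)
Definition nest_points (t : seq arc) (f : option 'I_n) : seq 'I_n :=
  [seq e.1 | e <- t] ++ seq_of_opt f ++ rev [seq e.2 | e <- t].

Definition increasing (s : seq 'I_n) : bool :=
  sorted [rel x y : 'I_n | x < y] s.

(* The nested arcs are listed in t from the outermost to the innermost. *)
Definition nesting (A : {set arc}) (k : nat) (t : seq arc) : bool :=
  [&& size t == k, all (mem A) t & increasing (nest_points t None)].

Definition enhanced_nesting (d : diagram) (k : nat) (t : seq arc)
    (f : option 'I_n) : bool :=
  if f is Some v then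
    [&& (size t).+1 == k, all (mem (arcs (upper d))) t, is_fixed d v
      & increasing (nest_points t (Some v))]
  else nesting (arcs (upper d)) k t.

Definition right_of (a : 'I_n) (s : seq 'I_n) : bool :=
  all (fun v : 'I_n => a < v) s.

Definition has_enhanced_nesting (d : diagram) (k : nat) : bool :=
  [exists t : k.-bseq arc, exists f : option 'I_n, enhanced_nesting d k t f].

Definition has_lower_nesting (d : diagram) (k : nat) : bool :=
  [exists t : k.-bseq arc, nesting (arcs (lower d)) k t].

(* The semi-arc at a belongs to a future enhanced upper k-nesting.  The empty
   set is a 0-nesting, so that every semi-arc is a future 1-nesting. *)
Definition in_future_enhanced (d : diagram) (k : nat) (a : 'I_n) : bool :=
  [&& 0 < k, a \in semiarcs (upper d)
    & [exists t : k.-1.-bseq arc, exists f : option 'I_n,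
        enhanced_nesting d k.-1 t f && right_of a (nest_points t f)]].

Definition in_future_lower (d : diagram) (k : nat) (a : 'I_n) : bool :=
  [&& 0 < k, a \in semiarcs (lower d)
    & [exists t : k.-1.-bseq arc,
        nesting (arcs (lower d)) k.-1 t && right_of a (nest_points t None)]].

Definition nonnesting (k : nat) (d : diagram) : bool :=
  [&& ~~ has_enhanced_nesting d k,
      ~~ [exists a, in_future_enhanced d k a],
      ~~ has_lower_nesting d k
    & ~~ [exists a, in_future_lower d k a]].

(* The bound j <= n loses nothing: a j-nesting, enhanced or not, has at least
   j vertices. *)
Definition enhanced_nesting_index (d : diagram) (a : 'I_n) : nat :=
  \max_(j < n.+1 | in_future_enhanced d j.+1 a) j.
Definition lower_nesting_index (d : diagram) (a : 'I_n) : nat :=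
  \max_(j < n.+1 | in_future_lower d j.+1 a) j.

End Diagrams.

Definition Sigma (k n : nat) : {set diagram n} :=
  [set d | is_open_diagram d && nonnesting k.+1 d].

(* [h; r_1, ..., r_(k-1); s_1, ..., s_(k-1)] *)
Definition label (k : nat) := (nat * k.-1.-tuple nat * k.-1.-tuple nat)%type.

(* The label attached to a member of [Sigma k n].  The succession rule below
   describes how it evolves when a vertex is added on the right; counting the
   diagrams by size does not refer to it. *)
Definition diagram_label (k n : nat) (d : diagram n) : label k :=
  ((#|semiarcs (upper d)| + #|semiarcs (lower d)|)./2,
   [tuple of [seq #|[set a in semiarcs (upper d)
                     | i <= enhanced_nesting_index d a]| | i <- iota 1 k.-1]],
   [tuple of [seq #|[set a in semiarcs (lower d)
                     | i <= lower_nesting_index d a]| | i <- iota 1 k.-1]]).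

Section SuccessionRule.

Variable k : nat.
Implicit Types r s : k.-1.-tuple nat.

(* r_i for 0 <= i <= k-1, with r_0 = h. *)
Definition entry (h : nat) r (i : nat) : nat := nth 0 (h :: r) i.

(* r - 1.  The predecessor is truncated at 0, which is harmless: in every
   label of the generating tree, h >= r_1 >= ... >= r_(k-1), and r - 1 only
   occurs when r_(k-1) >= 1.  Likewise R_(j,i) only occurs when
   r_1 >= ... >= r_(j-1) >= 1. *)
Definition decr r : k.-1.-tuple nat := [tuple of [seq x.-1 | x <- r]].

(* R_(j,i) = (r_1 - 1, ..., r_(j-1) - 1, i, r_(j+1), ..., r_(k-1)); the same
   function applied to s gives S_(j,i). *)
Definition replace_at r (j i : nat) : k.-1.-tuple nat :=
  [tuple of [seq (if l < j then (entry 0 r l).-1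
                  else if l == j then i else entry 0 r l) | l <- iota 1 k.-1]].

(* (h, r_2, ..., r_(k-1)) *)
Definition set_first (h : nat) r : k.-1.-tuple nat :=
  [tuple of [seq (if l == 1 then h else entry h r l) | l <- iota 1 k.-1]].

(* The pairs (j,i) with 1 <= j <= k-1 and r_j <= i <= r_(j-1) - 1, as integers:
   there are none for j when r_(j-1) = 0. *)
Definition index_pairs (h : nat) r : seq (nat * nat) :=
  [seq (j, i) | j <- index_iota 1 k,
                i <- index_iota (entry h r j) (entry h r j.-1)].

Definition succession (L : label k) : seq (label k) :=
  let: (h, r, s) := L in
  let Ir := index_pairs h r in
  let Is := index_pairs h s in
  let r_pos := 0 < entry h r k.-1 in
  let s_pos := 0 < entry h s k.-1 in
  let R (p : nat * nat) := replace_at r p.1 p.2 in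
  let S (q : nat * nat) := replace_at s q.1 q.2 in
     (* fixed point, opener *)
     [:: (h, set_first h r, s); (h.+1, r, s)]
     (* upper transitory vertices *)
  ++ (if r_pos then [:: (h, decr r, s)] else [::])
  ++ [seq (h, R p, s) | p <- Ir]
     (* lower transitory vertices *)
  ++ (if s_pos then [:: (h, r, decr s)] else [::])
  ++ [seq (h, r, S q) | q <- Is]
     (* closers *)
  ++ (if r_pos && s_pos then [:: (h.-1, decr r, decr s)] else [::])
  ++ (if r_pos then [seq (h.-1, decr r, S q) | q <- Is] else [::])
  ++ (if s_pos then [seq (h.-1, R p, decr s) | p <- Ir] else [::])
  ++ [seq (h.-1, R p, S q) | p <- Ir, q <- Is].

Definition root_label : label k :=
  (0, [tuple of nseq k.-1 0], [tuple of nseq k.-1 0]).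

End SuccessionRule.

(* The labels of the nodes at level n of the generating tree with the given
   root label and succession rule: one entry per node, so that repetitions
   count and the number of nodes at level n is the size of this list. *)
Fixpoint tree_level (T : Type) (rule : T -> seq T) (root : T) (n : nat)
    : seq T :=
  if n is m.+1 then flatten [seq rule L | L <- tree_level rule root m]
  else [:: root].

(* Main.v *)
(* Deleting the last vertex of a (k+1)-nonnesting open permutation diagram turns
   the arcs that end there into semi-arcs and leaves a (k+1)-nonnesting open
   permutation diagram.  Conversely, a new last vertex is a fixed point, an
   opener, or closes one semi-arc on one or on both sides.  On one side, the
   semi-arcs of nesting index >= j are the r_j leftmost ones.  Closing the
   semi-arc at position p (counted from 0) makes it the outermost arc of a
   nesting, and this matters only for the semi-arcs on its left: r_j becomes
   r_j - 1 if p < r_j, p if r_j <= p < r_(j-1), and is unchanged if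
   r_(j-1) <= p.  No forbidden nesting appears if and only if p = 0 or
   p >= r_(k-1).  So the labels of the children of a diagram are exactly those
   listed by the succession rule. *)

From mathcomp Require Import all_boot zify.
Require Import Defs.

Set Implicit Arguments.
Unset Strict Implicit.
Unset Printing Implicit Defensive.

Arguments arcs : simpl never.
Arguments semiarcs : simpl never.

(** * Nestings as a recursive predicate on depth and interval *)

Section Nested.

Variable n : nat.
Implicit Types (A : {set arc n}) (X : {set 'I_n}) (t : seq (arc n)).

(* There is an m-nesting of arcs of A with all its vertices in [lb, ub), its
   innermost arc being possibly replaced by a point of X. *)
Fixpoint nested A X (m lb ub : nat) : bool :=
  if m is m'.+1 then
    [exists e in A, [&& lb <= e.1, e.1 < e.2, e.2 < ub
                      & nested A X m' e.1.+1 e.2]]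
    || (m' == 0) && [exists v in X, lb <= v < ub]
  else true.

(** Common form of both notions of nesting: [X] is the set of fixed points on the upper side and
    [set0] on the lower side, where no point may replace the innermost arc. *)
Definition gen_nesting A X m t (f : option 'I_n) : bool :=
  [&& size t + isSome f == m, all (mem A) t, (if f is Some v then v \in X else true)
    & increasing (nest_points t f)].

Lemma increasing_cons_rcons (a b : 'I_n) s :
  increasing (a :: rcons s b) =
  [&& a < b, increasing s & all (fun v : 'I_n => a < v < b) s].
Proof.
have tr : transitive [rel x y : 'I_n | x < y] by move=> y x z /=; apply: ltn_trans.
rewrite /increasing !sorted_pairwise // pairwise_cons all_rcons pairwise_rcons.
have ->: all (fun v : 'I_n => a < v < b) s =
          all (fun v : 'I_n => a < v) s && all (fun v : 'I_n => v < b) s.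
  by rewrite -all_predI.
by rewrite /= -!andbA; congr (_ && _); rewrite [RHS]andbCA; congr (_ && _); rewrite andbC.
Qed.

(** Induction on [m], peeling off the outermost arc: its ends are the first and the last point, and
    the other points lie strictly between them, in the interval of the recursive call. *)
Lemma nestedP A X m lb ub :
  reflect (exists t f, gen_nesting A X m t f /\
                       all (fun v : 'I_n => lb <= v < ub) (nest_points t f))
          (nested A X m lb ub).
Proof.
have nest_cons e t f : nest_points (e :: t) f = e.1 :: rcons (nest_points t f) e.2.
  by rewrite /nest_points /= rev_cons -!rcons_cat.
elim: m lb ub => [|m IHm] lb ub.
  by apply: (iffP idP) => // _; exists [::], None.
apply: (iffP orP) => [[]|].
- case/existsP => e /and5P[Ae lbe e12 eub /IHm[t [f [/and4P[/eqP <- At Xf it] bt]]]].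
  exists (e :: t), f; rewrite /gen_nesting nest_cons increasing_cons_rcons /= Ae At Xf e12 it.
  rewrite addSn eqxx all_rcons /= lbe eub (ltn_trans e12 eub) (leq_trans lbe (ltnW e12)) bt.
  split=> //; apply: sub_all bt => v; lia.
- case/andP=> /eqP -> /existsP[v /andP[Xv bv]].
  by exists [::], (Some v); rewrite /gen_nesting /= Xv bv.
case=> [[|e t] [f [/and4P[/eqP sz At Xf]]]].
  case: f Xf sz => [v|] //= Xv [<-] _; rewrite andbT => bv; right.
  by rewrite eqxx; apply/existsP; exists v; rewrite Xv.
rewrite nest_cons increasing_cons_rcons /= all_rcons => /and3P[e12 it bt] /and3P[be1 be2 _].
case/andP: At => Ae At; left; apply/existsP; exists e; rewrite (Ae : e \in A) e12 /=.
have [-> ->] : lb <= e.1 /\ e.2 < ub by lia.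
apply/IHm; exists t, f; split=> //; apply/and4P; split=> //; by case: sz => <-.
Qed.

Lemma nested_lb A X m lb lb' ub :
  lb' <= lb -> nested A X m lb ub -> nested A X m lb' ub.
Proof.
move=> le_lb; case: m => //= m /orP[] /=.
  case/existsP => e /and5P[Ae lbe e12 eub ne]; apply/orP; left.
  by apply/existsP; exists e; rewrite Ae e12 eub ne (leq_trans le_lb).
case/andP=> -> /existsP[v /and3P[Xv lbv vub]]; apply/orP; right.
by apply/existsP; exists v; rewrite Xv vub (leq_trans le_lb).
Qed.

(** The innermost arc or point is dropped. At depth 2 or more the outermost member is an arc, so the
    induction step only meets the first disjunct. *)
Lemma nested_pred A X m lb ub : nested A X m.+1 lb ub -> nested A X m lb ub.
Proof.
elim: m lb ub => [|m IHm] lb ub //=.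
rewrite orbF => /existsP[e /and5P[Ae lbe e12 eub ne]]; apply/orP; left.
by apply/existsP; exists e; rewrite Ae lbe e12 eub; apply: IHm.
Qed.

(** As [nested] is monotone in the depth, these are the semi-arcs of nesting index at least [j];
    their number is [r_j] or [s_j]. *)
Definition futures (H : side n) X (j : nat) : {set 'I_n} :=
  [set a in semiarcs H | nested (arcs H) X j a.+1 n].

Definition side_nonnesting (k : nat) (H : side n) X : bool :=
  ~~ nested (arcs H) X k 0 n && (futures H X k.-1 == set0).

Definition fixed_points (d : diagram n) : {set 'I_n} := [set v | is_fixed d v].

Lemma gen_nesting0 A m t f :
  gen_nesting A set0 m t f = (if f is None then nesting A m t else false).
Proof.
by case: f => [v|]; rewrite /gen_nesting /nesting ?inE ?andbF //= addn0.
Qed.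

Lemma gen_nesting_enhanced (d : diagram n) m t f :
  enhanced_nesting d m t f = gen_nesting (arcs (upper d)) (fixed_points d) m t f.
Proof.
by case: f => [v|]; rewrite /gen_nesting /= ?inE ?addn1 ?addn0.
Qed.

(** Serves twice: [lb = 0] gives the plain nestings, [lb = a.+1] those to the right of a semi-arc at
    [a]. *)
Lemma nested_enhanced (d : diagram n) m lb :
  [exists t : m.-bseq (arc n), exists f : option 'I_n,
     enhanced_nesting d m t f && all (fun v : 'I_n => lb <= v) (nest_points t f)]
  = nested (arcs (upper d)) (fixed_points d) m lb n.
Proof.
apply/existsP/nestedP => [[t /existsP[f /andP[]]]|[t [f []]]].
  rewrite gen_nesting_enhanced => ne bt; exists t, f; split=> //.
  by apply: sub_all bt => v /= ->; rewrite ltn_ord.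
move=> ne bt; have sz: size t <= m by case/andP: ne => /eqP <- _; rewrite leq_addr.
exists (Bseq sz); apply/existsP; exists f.
rewrite gen_nesting_enhanced ne /=.
by apply: sub_all bt => v /andP[].
Qed.

Lemma nested_lower A m lb :
  [exists t : m.-bseq (arc n),
     nesting A m t && all (fun v : 'I_n => lb <= v) (nest_points t None)]
  = nested A set0 m lb n.
Proof.
apply/existsP/nestedP => [[t /andP[ne bt]]|[t [f []]]].
  exists t, None; rewrite gen_nesting0; split=> //.
  by apply: sub_all bt => v /= ->; rewrite ltn_ord.
rewrite gen_nesting0; case: f => // ne bt.
have sz: size t <= m by case/andP: ne => /eqP <- _.
exists (Bseq sz); rewrite ne /=.
by apply: sub_all bt => v /andP[].
Qed.

Lemma nonnestingE (d : diagram n) k :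
  nonnesting k.+1 d =
  side_nonnesting k.+1 (upper d) (fixed_points d) && side_nonnesting k.+1 (lower d) set0.
Proof.
rewrite /nonnesting -!andbA; congr [&& ~~ _, _, ~~ _ & _].
- rewrite -nested_enhanced; apply: eq_existsb => t; apply: eq_existsb => f.
  by rewrite [X in _ && X](introT allP) ?andbT.
- apply/existsPn/eqP => [noa|fut0 a].
    apply/setP=> a; rewrite !inE -nested_enhanced; have:= noa a.
    by rewrite /in_future_enhanced /=; case: (a \in _) => //= /negbTE.
  by move/setP/(_ a): fut0; rewrite !inE -nested_enhanced => /negbT.
- rewrite -nested_lower; apply: eq_existsb => t.
  by rewrite [X in _ && X](introT allP) ?andbT.
apply/existsPn/eqP => [noa|fut0 a].
  apply/setP=> a; rewrite !inE -nested_lower; have:= noa a.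
  by rewrite /in_future_lower /=; case: (a \in _) => //= /negbTE.
by move/setP/(_ a): fut0; rewrite !inE -nested_lower => /negbT.
Qed.

End Nested.

(** * Adding a last vertex to one side of the row *)

Section Extension.

Variable n : nat.
Implicit Types (H : side n) (X : {set 'I_n}) (c : option 'I_n) (o b : bool).

Local Notation w := (lift (@ord_max n)).

(* Addition of a vertex on the right of one side of the row: it closes the
   semi-arc c, if any, and it carries a new semi-arc if o holds. *)
Definition extend_side H c o : side n.+1 :=
  ([set e : arc n.+1 |
     match unlift ord_max e.1, unlift ord_max e.2 with
     | Some a, Some b => (a, b) \in arcs H
     | Some a, None => c == Some a
     | None, _ => false
     end],
   [set v | if unlift ord_max v is Some a
            then (a \in semiarcs H) && (c != Some a) else o]).

Definition extend_set X b : {set 'I_n.+1} :=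
  [set v | if unlift ord_max v is Some a then a \in X else b].

Lemma extend_arc_old H c o (a b : 'I_n) :
  ((w a, w b) \in arcs (extend_side H c o)) = ((a, b) \in arcs H).
Proof. by rewrite inE /= !liftK. Qed.

Lemma extend_arc_new H c o (a : 'I_n) :
  ((w a, ord_max) \in arcs (extend_side H c o)) = (c == Some a).
Proof. by rewrite inE /= liftK unlift_none. Qed.

Lemma extend_arc_max H c o v : ((ord_max, v) \in arcs (extend_side H c o)) = false.
Proof. by rewrite inE /= unlift_none. Qed.

Lemma extend_semi_old H c o (a : 'I_n) :
  (w a \in semiarcs (extend_side H c o)) = (a \in semiarcs H) && (c != Some a).
Proof. by rewrite inE /= liftK. Qed.

Lemma extend_semi_max H c o : (ord_max \in semiarcs (extend_side H c o)) = o.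
Proof. by rewrite inE /= unlift_none. Qed.

Lemma extend_set_old X b (a : 'I_n) : (w a \in extend_set X b) = (a \in X).
Proof. by rewrite inE liftK. Qed.

Lemma extend_set_max X b : (ord_max \in extend_set X b) = b.
Proof. by rewrite inE unlift_none. Qed.

Definition extendE := (extend_arc_old, extend_arc_new, extend_arc_max,
  extend_semi_old, extend_semi_max, extend_set_old, extend_set_max).

Lemma forall_ordS (P : 'I_n.+1 -> Prop) :
  (forall a, P (w a)) -> P ord_max -> forall v, P v.
Proof. by move=> Pw Pmax v; case: (unliftP ord_max v) => [a|] ->. Qed.

Lemma nested_extend_old H X c o b m lb ub : ub <= n ->
  nested (arcs (extend_side H c o)) (extend_set X b) m lb ub =
  nested (arcs H) X m lb ub.
Proof.
elim: m lb ub => [|m IHm] lb ub ubn //=.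
congr (_ || _ && _); apply/existsP/existsP.
- case=> -[e1 e2] /=; elim/forall_ordS: e1 => [a1|]; last by rewrite extendE.
  elim/forall_ordS: e2 => [a2|]; last by rewrite [ord_max : nat]/=; lia.
  rewrite extendE !lift_max => /and5P[Aa lba a12 a2b ne].
  exists (a1, a2); rewrite Aa lba a12 a2b /= -IHm //; lia.
- case=> -[a1 a2] /and5P[/= Aa lba a12 a2b ne].
  exists (w a1, w a2); rewrite extendE !lift_max Aa lba a12 a2b /= IHm //; lia.
- case=> v; elim/forall_ordS: v => [a|]; last by rewrite [ord_max : nat]/=; lia.
  by rewrite extendE lift_max => ?; exists a.
- by case=> a ?; exists (w a); rewrite extendE lift_max.
Qed.

(** The new vertex is the rightmost one, so an arc ending there can only be outermost, and a point
    there is enclosed by no arc and yields a 1-nesting only. *)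
Lemma nested_extend H X c o b m lb : lb <= n ->
  nested (arcs (extend_side H c o)) (extend_set X b) m lb n.+1 =
  [|| nested (arcs H) X m lb n,
      (if c is Some x then [&& 0 < m, lb <= x & nested (arcs H) X m.-1 x.+1 n]
       else false)
    | b && (m == 1)].
Proof.
case: m => [|m] lbn //=; apply/idP/idP.
- case/orP => [/existsP[[e1 e2]]|/andP[m0 /existsP[v]]] /=.
    elim/forall_ordS: e1 => [a1|]; last by rewrite extendE.
    elim/forall_ordS: e2 => [a2|].
      rewrite extendE !lift_max => /and5P[Aa lba a12 a2n].
      rewrite nested_extend_old ?(ltnW (ltn_ord a2)) // => ne.
      apply/orP; left; apply/orP; left; apply/existsP; exists (a1, a2).
      by rewrite Aa lba a12 ltn_ord.
    rewrite extendE !lift_max nested_extend_old // => /and5P[/eqP-> lba _ _ ne].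
    by rewrite lba ne orbT.
  elim/forall_ordS: v => [a|].
    rewrite extendE lift_max => /and3P[Xa lba an].
    apply/orP; left; apply/orP; right; rewrite m0; apply/existsP; exists a.
    by rewrite Xa lba ltn_ord.
  by rewrite extendE => /andP[-> _]; rewrite eqSS m0 !orbT.
- case/or3P => [/orP[/existsP[[a1 a2]]|/andP[m0 /existsP[a]]]|| /andP[b1 m0]] /=.
  + case/and5P=> /= Aa lba a12 a2n ne; apply/orP; left; apply/existsP.
    exists (w a1, w a2); rewrite extendE !lift_max Aa lba a12 /= ltnW //=.
    by rewrite nested_extend_old // ltnW.
  + case/and3P=> /= Xa lba an; apply/orP; right; rewrite m0; apply/existsP.
    by exists (w a); rewrite extendE lift_max Xa lba ltnW.
  + case: c => // x /andP[lbx ne]; apply/orP; left; apply/existsP.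
    exists (w x, ord_max); rewrite extendE !lift_max eqxx lbx /= ltn_ord ltnSn /=.
    by rewrite nested_extend_old.
  + apply/orP; right; rewrite -eqSS m0; apply/existsP.
    by exists ord_max; rewrite extendE b1 /= lbn ltnSn.
Qed.

Lemma mem_futures_old H X c o b j (a : 'I_n) :
  (w a \in futures (extend_side H c o) (extend_set X b) j) =
  [&& a \in semiarcs H, c != Some a &
      [|| a \in futures H X j,
      (if c is Some x then [&& 0 < j, a < x & nested (arcs H) X j.-1 x.+1 n]
       else false)
    | b && (j == 1)]].
Proof.
rewrite in_set extendE lift_max nested_extend // in_set -andbA.
by case: (a \in semiarcs H).
Qed.

Lemma mem_futures_max H X c o b j :
  (ord_max \in futures (extend_side H c o) (extend_set X b) j) = o && (j == 0).
Proof.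
rewrite in_set extendE; congr (_ && _).
case: j => [|j] //=; apply/negbTE; rewrite negb_or negb_and; apply/andP; split.
  by apply/existsPn => e; have := ltn_ord e.1; have := ltn_ord e.2; lia.
by apply/orP; right; apply/existsPn => e; have := ltn_ord e; lia.
Qed.

Lemma sum_ordS (F : 'I_n.+1 -> nat) :
  \sum_v F v = \sum_a F (w a) + F ord_max.
Proof.
rewrite big_ord_recr; congr (_ + _); apply: eq_bigr => a _; congr F.
by apply/val_inj; rewrite /= /bump leqNgt ltn_ord.
Qed.

Lemma card_ord_sum m (A : {set 'I_m}) : #|A| = \sum_a (a \in A).
Proof. by rewrite -sum1_card big_mkcond; apply: eq_bigr => a _; case: (a \in A). Qed.

Lemma card_setS (A : {set 'I_n.+1}) :
  #|A| = #|[set a | w a \in A]| + (ord_max \in A).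
Proof.
by rewrite !card_ord_sum sum_ordS; congr (_ + _); apply: eq_bigr => a _; rewrite inE.
Qed.

(** A new fixed point is a 1-nesting to the right of every semi-arc: all of them reach level 1, and
    no other level is affected. *)
Lemma card_futures_extend H X o b j :
  #|futures (extend_side H None o) (extend_set X b) j| =
  (if b && (j == 1) then #|semiarcs H| else #|futures H X j|) + o && (j == 0).
Proof.
rewrite card_setS mem_futures_max; congr (_ + _).
case: ifP => bj; apply: eq_card => a; rewrite inE mem_futures_old bj /= ?orbT ?andbT //.
by rewrite orbF inE; case: (_ \in _).
Qed.


(** * Positions of semi-arcs and the effect of a closure *)

Definition position (S : {set 'I_n}) (x : 'I_n) : nat := #|[set a in S | a < x]|.

Lemma futures0 H X : futures H X 0 = semiarcs H.
Proof. by apply/setP=> a; rewrite inE andbT. Qed.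

Lemma futures_pred H X j : futures H X j.+1 \subset futures H X j.
Proof.
by apply/subsetP=> a; rewrite !in_set => /andP[-> /nested_pred].
Qed.

Lemma futures_left H X j (a a' : 'I_n) :
  a \in semiarcs H -> a <= a' -> a' \in futures H X j -> a \in futures H X j.
Proof.
move=> Sa le_aa'; rewrite !in_set Sa => /andP[_]; exact: nested_lb.
Qed.

(** By [futures_left], each level is an initial segment of the semi-arcs, so position decides
    membership. *)
Lemma mem_futures_position H X j x : x \in semiarcs H ->
  (x \in futures H X j) = (position (semiarcs H) x < #|futures H X j|).
Proof.
move=> Sx; apply/idP/idP => [Fx|].
  apply: proper_card; apply/properP; split.
    apply/subsetP => a; rewrite inE => /andP[Sa /ltnW le_ax].
    exact: futures_left Fx.
  by exists x => //; rewrite inE ltnn andbF.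
apply: contraLR => nFx; rewrite -leqNgt; apply: subset_leq_card.
apply/subsetP => a Fa; have Sa: a \in semiarcs H by move: Fa; rewrite inE => /andP[].
rewrite inE Sa ltnNge; apply: contra nFx => le_xa; exact: futures_left Fa.
Qed.

(* The new value of r_j when the semi-arc at position p is closed, for r = r_j
   and r' = r_(j-1). *)
Definition close_rank (p r r' : nat) : nat :=
  if p < r then r.-1 else if p < r' then p else r.

(** Closing [x] brings the semi-arcs on its left to level [j] if [x] is at level [j.-1]. If [x] is
    even at level [j], they were there already and only [x] is lost; if not, level [j] becomes all
    that lies left of [x]. If [x] is below level [j.-1], nothing changes. *)
Lemma card_futures_close H X x o j : x \in semiarcs H -> 0 < j ->
  #|futures (extend_side H (Some x) o) (extend_set X false) j| =
  close_rank (position (semiarcs H) x) #|futures H X j| #|futures H X j.-1|.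
Proof.
move=> Sx j0; rewrite card_setS mem_futures_max -(negbK (j == 0)) -lt0n j0 andbF addn0.
rewrite /close_rank -!mem_futures_position //.
have memE a : (a \in [set a | w a \in futures (extend_side H (Some x) o)
                                     (extend_set X false) j]) =
    [&& a \in semiarcs H, x != a & (a \in futures H X j)
       || (a < x) && (x \in futures H X j.-1)].
  by rewrite inE mem_futures_old j0 orbF [x \in futures _ _ _]in_set Sx.
case: ifP => Fx.
  rewrite [in RHS](cardsD1 x) Fx /=; apply: eq_card => a; rewrite memE in_setD1 eq_sym.
  case: (boolP (a \in semiarcs H)) => [Sa|nSa]; last first.
    by rewrite in_set (negbTE nSa) andbF.
  congr (_ && _); case: (ltnP a x) => [ltax|]; last by rewrite orbF.
  by rewrite (futures_left Sa (ltnW ltax)).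
(* An initial segment that misses [x] lies wholly to the left of [x]. *)
have lt_x a : a \in futures H X j -> a < x.
  rewrite ltnNge => Fa; apply/negP => le_xa.
  by rewrite (futures_left Sx le_xa Fa) in Fx.
case: ifP => F'x; apply: eq_card => a; rewrite memE F'x.
  rewrite [in RHS]in_set andbT; congr (_ && _); case: (ltnP a x) => [ltax|lexa].
    by rewrite orbT andbT; apply: contraTneq ltax => ->; rewrite ltnn.
  by rewrite orbF; apply/negP => /andP[_ /lt_x]; rewrite ltnNge lexa.
rewrite andbF orbF; case: (boolP (a \in futures H X j)) => Fa; last by rewrite !andbF.
have -> : a \in semiarcs H by move: Fa; rewrite inE => /andP[].
by rewrite andbT; apply/eqP => xa; rewrite xa Fa in Fx.
Qed.

Definition closing_in (S : {set 'I_n}) c : bool :=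
  if c is Some x then x \in S else true.

(** [isSome c] stands on the left so that no truncated subtraction occurs. *)
Lemma card_semiarcs_extend H c o : closing_in (semiarcs H) c ->
  #|semiarcs (extend_side H c o)| + isSome c = #|semiarcs H| + o.
Proof.
rewrite card_setS extendE; case: c => [x|] Sx; last first.
  by rewrite addn0; congr (_ + _); apply: eq_card => a; rewrite inE extendE andbT.
rewrite (cardsD1 x (semiarcs H)) (Sx : x \in _) addnC addnA; congr (_ + _ + _).
by apply: eq_card => a; rewrite !inE liftK andbC eq_sym.
Qed.

(* If this fails, closing x creates a k-nesting to the right of a semi-arc that
   stays open, that is, a future (k+1)-nesting. *)
Definition closable (k : nat) H X (x : 'I_n) : bool :=
  (x \notin futures H X k.-1) || (position (semiarcs H) x == 0).

(** A new nesting of size [k.+1] has the closed arc outermost, so it was a future one in [H]; the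
    only new danger is a future nesting, which [closable] excludes. A new fixed point yields depth 1
    only, harmless as [1 < k]. *)
Lemma side_nonnesting_extend k H X c o b : 1 < k -> closing_in (semiarcs H) c ->
  side_nonnesting k.+1 (extend_side H c o) (extend_set X b) =
  side_nonnesting k.+1 H X && (if c is Some x then closable k H X x else true).
Proof.
move=> k1 Sc; rewrite /side_nonnesting nested_extend //=.
have -> : (k.+1 == 1) = false by lia.
rewrite andbF orbF; apply/idP/idP.
- case/andP; rewrite negb_or => /andP[-> nc] /eqP F0 /=; apply/andP; split.
    apply/eqP/setP => a; rewrite [RHS]inE; apply/negP => Fa.
    have Sa: a \in semiarcs H by move: Fa; rewrite inE => /andP[].
    (* If [a] is the semi-arc being closed, its future nesting has become an actual one. *)
    have [ca|nca] := eqVneq c (Some a).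
      by move: nc; rewrite ca; move: Fa; rewrite inE => /andP[_ ->].
    by move/setP/(_ (w a)): F0; rewrite mem_futures_old Sa nca Fa inE.
  case: c Sc nc F0 => [x|] // Sx _ F0; rewrite /closable -implybE.
  apply/implyP => Fx; rewrite cards_eq0; apply/negPn/negP => /set0Pn[a].
  rewrite inE => /andP[Sa ltax].
  move/setP/(_ (w a)): F0; rewrite mem_futures_old Sa ltax in_set0.
  have -> : Some x != Some a by apply/eqP => -[xa]; rewrite xa ltnn in ltax.
  by move: Fx; rewrite inE => /andP[_ ->]; rewrite (ltnW k1) !orbT.
- case/andP => /andP[n1 /eqP F0] clc; rewrite negb_or n1 /=; apply/andP; split.
    case: c Sc clc => [x|] // Sx _; apply/negP => ne.
    by move/setP/(_ x): F0; rewrite !inE (Sx : x \in _) ne.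
  apply/eqP/setP; elim/forall_ordS => [a|]; last by rewrite mem_futures_max inE; lia.
  rewrite mem_futures_old F0 !inE /=; have -> : (k == 1) = false by lia.
  rewrite andbF orbF; case: c Sc clc => [x|] Sx clc; last by rewrite !andbF.
  apply/negP => /and5P[Sa _ _ ltax ne].
  move: clc; rewrite /closable in_set (Sx : x \in _) ne /=.
  by rewrite cards_eq0 => /eqP/setP/(_ a); rewrite !inE Sa ltax.
Qed.

(** * Vertex degrees, and recovering a side from its extension *)

Lemma card_arcs_left m (A : {set arc m}) v :
  #|[set e in A | e.1 == v]| = \sum_b ((v, b) \in A).
Proof.
have -> : [set e in A | e.1 == v] = pair v @: [set b | (v, b) \in A].
  apply/setP=> -[a b]; apply/idP/imsetP => [|[b']]; rewrite ?inE /=.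
    by case/andP=> Aab /eqP av; exists b; rewrite ?inE -av.
  by move=> Avb [-> ->]; rewrite eqxx andbT.
rewrite card_imset => [|? ? []//]; rewrite card_ord_sum.
by apply: eq_bigr => b _; rewrite inE.
Qed.

Lemma card_arcs_right m (A : {set arc m}) v :
  #|[set e in A | e.2 == v]| = \sum_a ((a, v) \in A).
Proof.
have -> : [set e in A | e.2 == v] = (pair^~ v) @: [set a | (a, v) \in A].
  apply/setP=> -[a b]; apply/idP/imsetP => [|[a']]; rewrite ?inE /=.
    by case/andP=> Aab /eqP bv; exists a; rewrite ?inE -bv.
  by move=> Aav [-> ->]; rewrite eqxx andbT.
rewrite card_imset => [|? ? []//]; rewrite card_ord_sum.
by apply: eq_bigr => b _; rewrite inE.
Qed.

(** A closed semi-arc at [a] is traded for an arc to the new vertex; [closing_in] ensures that it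
    was there. *)
Lemma lefts_extend_old H c o (a : 'I_n) : closing_in (semiarcs H) c ->
  lefts (extend_side H c o) (w a) = lefts H a.
Proof.
move=> Sc; rewrite /lefts !card_arcs_left sum_ordS !extendE -addnA; congr (_ + _).
  by apply: eq_bigr => b _; rewrite extendE.
by case: eqVneq Sc => [->|_] /=; rewrite ?andbT // => ->.
Qed.

Lemma rights_extend_old H c o (a : 'I_n) :
  rights (extend_side H c o) (w a) = rights H a.
Proof.
rewrite /rights !card_arcs_right sum_ordS extendE addn0.
by apply: eq_bigr => b _; rewrite extendE.
Qed.

Lemma lefts_extend_max H c o : lefts (extend_side H c o) ord_max = o.
Proof.
rewrite /lefts card_arcs_left extendE big1 // => b _; by rewrite extendE.
Qed.

Lemma rights_extend_max H c o : rights (extend_side H c o) ord_max = isSome c.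
Proof.
rewrite /rights card_arcs_right sum_ordS extendE addn0.
case: c => [x|]; last by rewrite big1 // => a _; rewrite extendE.
rewrite (bigD1 x) //= extendE eqxx big1 // => a nax; rewrite extendE.
by apply/eqP; rewrite eqb0; apply: contra nax => /eqP[->].
Qed.

Lemma side_eqP m (H1 H2 : side m) :
  arcs H1 =i arcs H2 -> semiarcs H1 =i semiarcs H2 -> H1 = H2.
Proof. by case: H1 H2 => [A1 S1] [A2 S2] /setP ? /setP ?; congr pair. Qed.

(** Deletion of the last vertex: an arc ending there is cut back to a semi-arc, unique by the bound
    on [rights]. *)
Lemma extend_side_surj (H' : side n.+1) :
  {in arcs H', forall e : arc n.+1, e.1 < e.2} -> (forall v, lefts H' v <= 1) ->
  rights H' ord_max <= 1 ->
  exists H c o, H' = extend_side H c o /\ closing_in (semiarcs H) c.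
Proof.
move=> lt12 left1 right1.
pose c : option 'I_n := [pick x : 'I_n | (w x, ord_max) \in arcs H'].
pose H : side n := ([set e | (w e.1, w e.2) \in arcs H'],
  [set a | (w a \in semiarcs H') || ((w a, ord_max) \in arcs H')]).
have cE (a : 'I_n) : ((w a, ord_max) \in arcs H') = (c == Some a).
  rewrite /c; case: pickP => [x Ax|-> //].
  apply/idP/eqP => [Aa|[<-] //]; congr Some.
  move: right1 => /card_le1_eqP/(_ (w x, ord_max) (w a, ord_max)).
  by rewrite !inE Ax Aa !eqxx => /(_ isT isT) /(congr1 fst) /= /lift_inj.
(* Left degree at most 1 forbids a semi-arc together with an arc to the last vertex, so the union in
   [H] can be undone. *)
have sc (a : 'I_n) : w a \in semiarcs H' -> c != Some a.
  rewrite -cE => Sa; apply/negP => Aa; have := left1 (w a).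
  rewrite /lefts Sa addn1 ltnS leqn0 cards_eq0 => /eqP/setP/(_ (w a, ord_max)).
  by rewrite !inE Aa eqxx.
exists H, c, (ord_max \in semiarcs H'); split.
  apply: side_eqP.
    case=> e1 e2; elim/forall_ordS: e1 => [a|].
      elim/forall_ordS: e2 => [b|]; last by rewrite extendE -cE.
      by rewrite extendE inE.
    rewrite extendE; apply/negP => /lt12 /=; have := ltn_ord e2; lia.
  elim/forall_ordS => [a|]; rewrite extendE // in_set -cE.
  move: (sc a); rewrite -cE.
  by case: (w a \in _) => [/(_ isT) -> //|_]; rewrite andbN.
rewrite /closing_in; case cx: c => [x|] //.
by rewrite inE cE cx eqxx orbT.
Qed.

(** The arcs into [ord_max] reveal which semi-arc was closed, and [closing_in] puts it back among
    the semi-arcs. *)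
Lemma extend_side_inj H1 c1 o1 H2 c2 o2 :
  closing_in (semiarcs H1) c1 -> closing_in (semiarcs H2) c2 ->
  extend_side H1 c1 o1 = extend_side H2 c2 o2 -> [/\ H1 = H2, c1 = c2 & o1 = o2].
Proof.
move=> Sc1 Sc2 eqE.
have c12 : c1 = c2.
  have cE a : (c1 == Some a) = (c2 == Some a).
    by rewrite -(extend_arc_new H1 c1 o1) eqE extendE.
  case: c1 c2 cE {Sc1 Sc2 eqE} => [x|] [y|] cE //.
  - by have:= cE x; rewrite eqxx => /esym/eqP ->.
  - by have:= cE x; rewrite eqxx.
  - by have:= cE y; rewrite eqxx.
split=> //; last by rewrite -(extend_semi_max H1 c1 o1) eqE extendE.
apply: side_eqP.
  case=> a b; have := extend_arc_old H1 c1 o1 a b.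
  by rewrite eqE extendE => ->.
move=> a; have := extend_semi_old H1 c1 o1 a.
rewrite eqE extendE -c12; have [c1a _|_] := eqVneq c1 (Some a).
  by move: Sc1 Sc2; rewrite -c12 c1a /= => -> ->.
by rewrite !andbT => ->.
Qed.

End Extension.

(** * Adding a last vertex to a whole diagram *)

Section Steps.

Variable n : nat.
Implicit Types (H : side n) (X : {set 'I_n}) (d : diagram n).

Local Notation w := (lift (@ord_max n)).

(* For the upper and then the lower side, the semi-arc closed by the new vertex
   and whether a new semi-arc is opened. *)
Definition step := ((option 'I_n * bool) * (option 'I_n * bool))%type.

Definition extend d (st : step) : diagram n.+1 :=
  (extend_side (upper d) st.1.1 st.1.2, extend_side (lower d) st.2.1 st.2.2).

(** In order: fixed point, opener, closer, upper transitory, lower transitory. *)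
Definition kinds : seq ((nat * nat) * (nat * nat)) :=
  [:: ((0, 0), (0, 0)); ((1, 0), (1, 0)); ((0, 1), (0, 1)); ((1, 1), (0, 0));
      ((0, 0), (1, 1))].

Definition kind (st : step) : (nat * nat) * (nat * nat) :=
  (((st.1.2 : nat), (isSome st.1.1 : nat)), ((st.2.2 : nat), (isSome st.2.1 : nat))).

Definition closings_in d (st : step) : bool :=
  closing_in (semiarcs (upper d)) st.1.1 && closing_in (semiarcs (lower d)) st.2.1.

Lemma is_open_diagramE m (d : diagram m) :
  is_open_diagram d =
  [&& [forall e in arcs (upper d), e.1 < e.2],
      [forall e in arcs (lower d), e.1 < e.2],
      [forall v, incidence d v \in kinds]
    & #|semiarcs (upper d)| == #|semiarcs (lower d)|].
Proof.
by congr [&& _, _, _ & _]; apply: eq_forallb => v; rewrite !inE.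
Qed.

Lemma incidence_extend_old d st a : closings_in d st ->
  incidence (extend d st) (w a) = incidence d a.
Proof.
by case/andP => Su Sl; rewrite /incidence !lefts_extend_old // !rights_extend_old.
Qed.

Lemma incidence_extend_max d st : incidence (extend d st) ord_max = kind st.
Proof. by rewrite /incidence !lefts_extend_max !rights_extend_max. Qed.

Lemma extend_arcs_lt H c o :
  [forall e in arcs (extend_side H c o), e.1 < e.2] = [forall e in arcs H, e.1 < e.2].
Proof.
apply/forall_inP/forall_inP => lt12.
  case=> a b Aab; have := lt12 (w a, w b); rewrite extendE /= => /(_ Aab).
  by rewrite /bump ![n <= _]leqNgt !ltn_ord.
case=> e1 e2; elim/forall_ordS: e1 => [a|]; last by rewrite extendE.
elim/forall_ordS: e2 => [b|] /=; last by rewrite /bump [n <= _]leqNgt !ltn_ord.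
rewrite extendE /bump ![n <= _]leqNgt !ltn_ord; exact: lt12 (a, b).
Qed.

(** Old vertices keep their incidence and the new one has [kind st]. The semi-arcs stay equinumerous
    because each of the five kinds changes both counts by the same amount. *)
Lemma is_open_extend d st : closings_in d st ->
  is_open_diagram (extend d st) = is_open_diagram d && (kind st \in kinds).
Proof.
move=> Sst; rewrite !is_open_diagramE !extend_arcs_lt -!andbA; do 2![congr (_ && _)].
have -> : [forall v, incidence (extend d st) v \in kinds] =
          [forall v, incidence d v \in kinds] && (kind st \in kinds).
  apply/forallP/andP => [inc|[/forallP inc kst]].
    split; last by rewrite -(incidence_extend_max d).
    by apply/forallP=> a; rewrite -(incidence_extend_old _ Sst).
  elim/forall_ordS => [a|]; last by rewrite incidence_extend_max.
  by rewrite incidence_extend_old.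
rewrite -andbA; congr (_ && _); rewrite [RHS]andbC.
case kst: (kind st \in kinds) => //=.
have /andP[/(card_semiarcs_extend st.1.2) + /(card_semiarcs_extend st.2.2)] := Sst.
move: kst; rewrite !inE /kind /extend /=.
case: st {Sst} => [[[x|] []] [[y|] []]] //= _ Eu El; lia.
Qed.

Lemma fixed_points_extend d st : closings_in d st ->
  fixed_points (extend d st) =
  extend_set (fixed_points d) (kind st == ((0, 0), (0, 0))).
Proof.
move=> Sst; apply/setP; elim/forall_ordS => [a|]; rewrite extendE inE /is_fixed.
  by rewrite incidence_extend_old // inE.
by rewrite incidence_extend_max.
Qed.

Lemma extend_set0 : extend_set (@set0 'I_n) false = set0.
Proof. by apply/setP; elim/forall_ordS => [a|]; rewrite extendE !inE. Qed.

Definition closings k H X := [seq x <- enum (semiarcs H) | closable k H X x].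

Definition allowed k H X (c : option 'I_n) : bool :=
  if c is Some x then x \in closings k H X else true.

Lemma allowedE k H X c :
  allowed k H X c = closing_in (semiarcs H) c &&
    (if c is Some x then closable k H X x else true).
Proof. by case: c => // x; rewrite /= mem_filter mem_enum andbC. Qed.

(** Grouped as in the succession rule: fixed point and opener, upper transitory, lower transitory,
    closers. *)
Definition steps (k : nat) d : seq step :=
  let U := closings k (upper d) (fixed_points d) in
  let L := closings k (lower d) set0 in
  [:: ((None, false), (None, false)); ((None, true), (None, true))]
  ++ [seq ((Some x, true), (None, false)) | x <- U]
  ++ [seq ((None, false), (Some y, true)) | y <- L]
  ++ [seq ((Some x, false), (Some y, false)) | x <- U, y <- L].

Lemma mem_steps k d st :
  (st \in steps k d) =
  [&& kind st \in kinds, allowed k (upper d) (fixed_points d) st.1.1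
    & allowed k (lower d) set0 st.2.1].
Proof.
rewrite !mem_cat; apply/idP/and3P => [|[]].
  case/or4P => [|/mapP[x Ux ->]|/mapP[y Ly ->]|/allpairsP[[x y] [Ux Ly ->]]] //=.
  by rewrite !inE => /orP[]/eqP ->.
move=> kst Ux Ly; apply/or4P; move: kst Ux Ly.
(* Of the sixteen shapes of a step, [kinds] leaves five; fixed point and opener share the first
   group. *)
case: st => [[[x|] []] [[y|] []]] //= _ Ux Ly.
- by constructor 2; apply/mapP; exists x.
- by constructor 4; apply/allpairsP; exists (x, y).
- by constructor 1.
- by constructor 3; apply/mapP; exists y.
- by constructor 1.
Qed.

Lemma uniq_steps k d : uniq (steps k d).
Proof.
have uU : uniq (closings k (upper d) (fixed_points d)) by rewrite filter_uniq ?enum_uniq.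
have uL : uniq (closings k (lower d) set0) by rewrite filter_uniq ?enum_uniq.
rewrite /steps !cat_uniq; apply/and3P; split=> //.
  rewrite !has_cat !negb_or; apply/and3P; split; apply/hasPn => st.
  - by case/mapP => x _ ->.
  - by case/mapP => x _ ->.
  - by case/allpairsP => x [_ _ ->].
apply/and3P; split; first by rewrite map_inj_uniq // => x y [].
  rewrite has_cat negb_or; apply/andP; split; apply/hasPn => st.
    by case/mapP => y _ ->; apply/mapP => -[].
  by case/allpairsP => x [_ _ ->]; apply/mapP => -[].
apply/and3P; split; first by rewrite map_inj_uniq // => x y [].
  by apply/hasPn => st /allpairsP[x [_ _ ->]]; apply/mapP => -[].
by apply: allpairs_uniq => // -[x1 y1] [x2 y2] _ _ /= [-> ->].
Qed.

Lemma extend_in_Sigma k d st : 1 < k -> closings_in d st ->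
  (extend d st \in Sigma k n.+1) = (d \in Sigma k n) && (st \in steps k d).
Proof.
move=> k1 Sst; rewrite mem_steps !in_set is_open_extend // !nonnestingE fixed_points_extend //.
rewrite -extend_set0 !allowedE; case/andP: (Sst) => Su Sl.
rewrite Su Sl !side_nonnesting_extend //=.
case: (is_open_diagram d) => //=; case: (kind st \in kinds); rewrite ?andbF //=.
by case: (side_nonnesting _ _ _) => //=; case: (side_nonnesting _ _ _); rewrite ?andbF //= andbT.
Qed.

Lemma steps_closings_in k d st : st \in steps k d -> closings_in d st.
Proof. by rewrite mem_steps !allowedE => /and3P[_ /andP[cu _] /andP[cl _]]; apply/andP. Qed.

Lemma extend_inj d1 st1 d2 st2 : closings_in d1 st1 -> closings_in d2 st2 ->
  extend d1 st1 = extend d2 st2 -> d1 = d2 /\ st1 = st2.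
Proof.
case/andP=> cu1 cl1 /andP[cu2 cl2] E12.
have [] := extend_side_inj cu1 cu2 (congr1 fst E12).
have [] := extend_side_inj cl1 cl2 (congr1 snd E12).
case: d1 d2 st1 st2 {cu1 cl1 cu2 cl2 E12} => u1 l1 [u2 l2] [[a1 b1] [c1 e1]] [[a2 b2] [c2 e2]].
by move=> /= -> -> -> -> -> ->.
Qed.

Lemma extend_surj (d' : diagram n.+1) : is_open_diagram d' ->
  exists d st, d' = extend d st /\ closings_in d st.
Proof.
rewrite is_open_diagramE => /and4P[/forall_inP ltu /forall_inP ltl /forallP inc _].
have inc1 v : [&& lefts (upper d') v <= 1, rights (upper d') v <= 1,
                  lefts (lower d') v <= 1 & rights (lower d') v <= 1].
  by move: (inc v); rewrite !inE /incidence => /or4P[||| /orP[]] /eqP[-> -> -> ->].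
have [u [cu [ou [Eu Su]]]] : exists u c o, upper d' = extend_side u c o /\
    closing_in (semiarcs u) c.
  apply: extend_side_surj => // [v|]; first by case/and4P: (inc1 v).
  by case/and4P: (inc1 ord_max).
have [l [cl [ol [El Sl]]]] : exists u c o, lower d' = extend_side u c o /\
    closing_in (semiarcs u) c.
  apply: extend_side_surj => // [v|]; first by case/and4P: (inc1 v).
  by case/and4P: (inc1 ord_max).
exists (u, l), ((cu, ou), (cl, ol)); rewrite /closings_in /= Su Sl; split=> //.
by case: d' Eu El {ltu ltl inc inc1} => u' l' /= -> ->.
Qed.

(** Both lists are duplicate-free, the second by [extend_inj], so comparing members suffices;
    [extend_surj] supplies the deletion of the last vertex. *)
Lemma perm_Sigma_extend k : 1 < k ->
  perm_eq (enum (Sigma k n.+1))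
          [seq extend d st | d <- enum (Sigma k n), st <- steps k d].
Proof.
move=> k1; apply: uniq_perm; first exact: enum_uniq.
  apply: allpairs_uniq_dep; [exact: enum_uniq | by move=> d _; exact: uniq_steps |].
  move=> _ _ /allpairsPdep[d1 [st1 [_ s1 ->]]] /allpairsPdep[d2 [st2 [_ s2 ->]]] /=.
  case/(extend_inj (steps_closings_in s1) (steps_closings_in s2)).
  by move=> d12 st12; rewrite d12 st12.
move=> d'; rewrite mem_enum; apply/idP/allpairsPdep => [Sd'|[d [st [Sd sst ->]]]].
  have [] := @extend_surj d'; first by move: Sd'; rewrite inE => /andP[].
  move=> d [st [Ed' Sst]]; move: Sd'; rewrite Ed' extend_in_Sigma // => /andP[Sd sst].
  by exists d, st; rewrite mem_enum.
by rewrite extend_in_Sigma ?(steps_closings_in sst) // -mem_enum Sd.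
Qed.

End Steps.

(** * Arithmetic of decreasing labels *)

Lemma cat_index_iota a b c : a <= b -> b <= c ->
  index_iota a b ++ index_iota b c = index_iota a c.
Proof.
move=> ab bc; rewrite /index_iota (_ : c - a = (b - a) + (c - b)); last lia.
by rewrite iotaD subnKC.
Qed.

Section Ranks.

Variable k : nat.
Implicit Types r s : k.-1.-tuple nat.

Lemma eq_ranks (f g : nat -> nat) : (forall l, 0 < l < k -> f l = g l) ->
  [tuple of [seq f l | l <- iota 1 k.-1]] = [tuple of [seq g l | l <- iota 1 k.-1]].
Proof.
move=> fg; apply: val_inj; apply/eq_in_map => l; rewrite mem_iota => lk; apply: fg; lia.
Qed.

Lemma entry_default h r l : 0 < l -> entry 0 r l = entry h r l.
Proof. by case: l. Qed.

Lemma map_entry h r (f : nat -> nat) :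
  [tuple of [seq f x | x <- r]] = [tuple of [seq f (entry h r l) | l <- iota 1 k.-1]].
Proof.
apply: val_inj; apply: (@eq_from_nth _ 0); rewrite /= !size_map ?size_tuple ?size_iota //.
move=> i ik; rewrite (nth_map 0) ?size_tuple // (nth_map 0) ?size_iota //.
by rewrite nth_iota.
Qed.

Definition close_ranks h r (p : nat) : k.-1.-tuple nat :=
  [tuple of [seq close_rank p (entry h r l) (entry h r l.-1) | l <- iota 1 k.-1]].

Section Decreasing.

Variables (h : nat) (r : k.-1.-tuple nat).
Hypothesis decr_entry : forall i, i.+1 < k -> entry h r i.+1 <= entry h r i.

Lemma entry_anti i j : i <= j -> j < k -> entry h r j <= entry h r i.
Proof.
elim: j => [|j IHj] ij jk; first by move: ij; rewrite leqn0 => /eqP ->.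
move: ij; rewrite leq_eqVlt => /orP[/eqP -> //|ij].
exact: leq_trans (decr_entry jk) (IHj ij (ltnW jk)).
Qed.

Lemma decr_close_ranks : 0 < entry h r k.-1 -> decr r = close_ranks h r 0.
Proof.
move=> e0; rewrite /decr (map_entry h); apply: eq_ranks => l /andP[l0 lk].
by rewrite /close_rank (leq_trans e0) // entry_anti; lia.
Qed.

(** In a decreasing sequence, [j] is the only place where [i] separates consecutive entries: earlier
    entries exceed [i] and drop by one; a later entry and its predecessor are at most [i], so it
    stays. *)
Lemma replace_at_close_ranks j i : 0 < j < k -> entry h r j <= i < entry h r j.-1 ->
  replace_at r j i = close_ranks h r i.
Proof.
move=> /andP[j0 jk] /andP[le_ji lt_ij]; apply: eq_ranks => l /andP[l0 lk].
rewrite !(@entry_default h) // /close_rank.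
case: (ltngtP l j) => [lt_lj|lt_jl|->].
- by rewrite (leq_trans lt_ij) // entry_anti; lia.
- have [] : entry h r l <= entry h r j /\ entry h r l.-1 <= entry h r j.
    by split; apply: entry_anti; lia.
  by move=> le1 le2; rewrite !ltnNge !(leq_trans _ le_ji).
- by rewrite lt_ij ltnNge le_ji.
Qed.

(** The intervals from [r_j] to [r_(j-1) - 1] tile the range from [r_m] to [h - 1]; increasing [j]
    lists them from right to left, hence only a permutation. *)
Lemma perm_index_pairs m : m < k ->
  perm_eq [seq q.2 | q <- [seq (j, i) | j <- index_iota 1 m.+1,
                             i <- index_iota (entry h r j) (entry h r j.-1)]]
          (index_iota (entry h r m) h).
Proof.
elim: m => [|m IHm] mk; first by rewrite /index_iota /= subnn.
rewrite [index_iota 1 _](_ : _ = index_iota 1 m.+1 ++ [:: m.+1]); last first.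
  by rewrite /index_iota !subSS !subn0 -(addn1 m) iotaD add1n addn1.
rewrite map_cat flatten_cat map_cat /= cats0 -map_comp map_id_in //.
rewrite perm_catC; apply: perm_trans (perm_cat (perm_refl _) (IHm (ltnW mk))) _.
rewrite cat_index_iota //; first exact: decr_entry.
exact: (@entry_anti 0 m _ (ltnW mk)).
Qed.

(** If [r_(k-1) = 0], every position lies in the tiled range; otherwise position 0 is an extra one
    and gives [decr r]. This accounts for the side conditions of the succession rule. *)
Lemma perm_close_ranks : 0 < k ->
  perm_eq [seq close_ranks h r p | p <- iota 0 h & (entry h r k.-1 <= p) || (p == 0)]
          ((if 0 < entry h r k.-1 then [:: decr r] else [::])
           ++ [seq replace_at r q.1 q.2 | q <- index_pairs h r]).
Proof.
move=> k0; have k1k : k.-1 < k by lia.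
have leh : entry h r k.-1 <= h by exact: (@entry_anti 0).
set e := entry h r k.-1 in leh *.
have Efilter : perm_eq [seq p <- iota 0 h | (e <= p) || (p == 0)]
                       ((if 0 < e then [:: 0] else [::]) ++ index_iota e h).
  apply: uniq_perm; first by rewrite filter_uniq ?iota_uniq.
    by case: ifP => e0 /=; rewrite iota_uniq ?andbT // mem_index_iota; lia.
  move=> p; rewrite mem_filter mem_cat mem_iota mem_index_iota.
  by case: ifP => e0; rewrite ?inE ?in_nil; lia.
apply: perm_trans (perm_map _ Efilter) _; rewrite map_cat; apply: perm_cat.
  by rewrite /e; case: ifP => // /decr_close_ranks ->.
have -> : [seq replace_at r q.1 q.2 | q <- index_pairs h r] =
          [seq close_ranks h r p | p <- [seq q.2 | q <- index_pairs h r]].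
  rewrite -map_comp; apply/eq_in_map => q /allpairsPdep[j [i [jk ik ->]]] /=.
  by apply: replace_at_close_ranks; move: jk ik; rewrite !mem_index_iota.
apply: perm_map; rewrite perm_sym /index_pairs -[X in index_iota 1 X](prednK k0).
exact: perm_index_pairs.
Qed.

End Decreasing.

End Ranks.

(** * Labels of diagrams and nodes of the generating tree *)

Section Labels.

Variable k : nat.
Hypothesis k1 : 1 < k.

Definition side_ranks n (H : side n) (X : {set 'I_n}) : k.-1.-tuple nat :=
  [tuple of [seq #|futures H X i| | i <- iota 1 k.-1]].

(** The label read through [futures]; the upper semi-arcs alone give [h], as an open diagram has
    equally many below. *)
Definition state n (d : diagram n) : label k :=
  (#|semiarcs (upper d)|, side_ranks (upper d) (fixed_points d), side_ranks (lower d) set0).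

Section Side.

Variable n : nat.
Implicit Types (H : side n) (X : {set 'I_n}).

Lemma entry_side_ranks H X i : i < k ->
  entry #|semiarcs H| (side_ranks H X) i = #|futures H X i|.
Proof.
case: i => [|i] ik; first by rewrite futures0.
by rewrite /entry /= (nth_map 0) ?size_iota ?nth_iota //; lia.
Qed.

Lemma side_ranks_decr H X i : i.+1 < k ->
  entry #|semiarcs H| (side_ranks H X) i.+1 <= entry #|semiarcs H| (side_ranks H X) i.
Proof.
move=> ik; rewrite !entry_side_ranks ?(ltnW ik) //.
exact/subset_leq_card/futures_pred.
Qed.

Lemma side_ranks_close H X x o : x \in semiarcs H ->
  side_ranks (extend_side H (Some x) o) (extend_set X false) =
  close_ranks #|semiarcs H| (side_ranks H X) (position (semiarcs H) x).
Proof.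
move=> Sx; apply: eq_ranks => l /andP[l0 lk].
by rewrite card_futures_close // !entry_side_ranks //; lia.
Qed.

Lemma side_ranks_open H X o :
  side_ranks (extend_side H None o) (extend_set X false) = side_ranks H X.
Proof.
apply: eq_ranks => l /andP[l0 lk]; rewrite card_futures_extend /=.
by rewrite -(negbK (l == 0)) -lt0n l0 andbF addn0.
Qed.

Lemma side_ranks_fixed H X :
  side_ranks (extend_side H None false) (extend_set X true) =
  set_first #|semiarcs H| (side_ranks H X).
Proof.
apply: eq_ranks => l /andP[l0 lk]; rewrite card_futures_extend /= addn0.
by case: ifP => // _; rewrite entry_side_ranks.
Qed.

(** Positions increase strictly along [S] and stay below its cardinal, so they fill the whole
    range. *)
Lemma perm_position (S : {set 'I_n}) :
  perm_eq [seq position S x | x <- enum S] (iota 0 #|S|).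
Proof.
have lt_pos (x y : 'I_n) : x \in S -> x < y -> position S x < position S y.
  move=> Sx ltxy; apply: proper_card; apply/properP; split.
    by apply/subsetP => a; rewrite !inE => /andP[-> ltax]; exact: ltn_trans ltxy.
  by exists x; rewrite !inE ?Sx ?ltnn.
have uniqp : uniq [seq position S x | x <- enum S].
  rewrite map_inj_in_uniq ?enum_uniq // => x y; rewrite !mem_enum => Sx Sy pxy.
  apply/val_inj; case: (ltngtP x y) => // [/(lt_pos _ _ Sx)|/(lt_pos _ _ Sy)];
    by rewrite pxy ltnn.
have sub_pos : {subset [seq position S x | x <- enum S] <= iota 0 #|S|}.
  move=> p /mapP[x]; rewrite mem_enum mem_iota add0n => Sx -> /=.
  apply: proper_card; apply/properP; split.
    by apply/subsetP => a; rewrite inE => /andP[].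
  by exists x; rewrite // inE ltnn andbF.
apply: uniq_perm => //; first exact: iota_uniq.
by move=> p; have [|_ ->] := uniq_min_size uniqp sub_pos; rewrite // size_map size_iota -cardE.
Qed.

(** [closable] means that the position is 0 or at least [r_(k-1)], which is the filter of
    [perm_close_ranks]. *)
Lemma perm_closings H X o :
  perm_eq [seq side_ranks (extend_side H (Some x) o) (extend_set X false)
             | x <- closings k H X]
    ((if 0 < entry #|semiarcs H| (side_ranks H X) k.-1
      then [:: decr (side_ranks H X)] else [::])
     ++ [seq replace_at (side_ranks H X) q.1 q.2
           | q <- index_pairs #|semiarcs H| (side_ranks H X)]).
Proof.
apply: perm_trans (perm_close_ranks (@side_ranks_decr H X) (ltnW k1)).
have -> : [seq side_ranks (extend_side H (Some x) o) (extend_set X false)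
             | x <- closings k H X] =
   [seq close_ranks #|semiarcs H| (side_ranks H X) p
     | p <- [seq position (semiarcs H) x | x <- closings k H X]].
  rewrite -map_comp; apply/eq_in_map => x; rewrite mem_filter mem_enum => /andP[_ Sx].
  exact: side_ranks_close.
apply: perm_map; rewrite perm_sym.
apply: perm_trans (_ : perm_eq [seq p <- [seq position (semiarcs H) x | x <- enum (semiarcs H)] |
   (entry #|semiarcs H| (side_ranks H X) k.-1 <= p) || (p == 0)] _).
  by apply: perm_filter; rewrite perm_sym perm_position.
rewrite filter_map; apply: perm_map.
rewrite (_ : filter _ _ = closings k H X) //; apply/eq_in_filter => x; rewrite mem_enum => Sx /=.
by rewrite entry_side_ranks /closable ?mem_futures_position -?leqNgt //; lia.
Qed.

End Side.

Lemma perm_steps n (d : diagram n) : is_open_diagram d ->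
  perm_eq [seq state (extend d st) | st <- steps k d] (succession (state d)).
Proof.
move=> od.
set h := #|semiarcs (upper d)|.
have hl : #|semiarcs (lower d)| = h.
  by move: od; rewrite is_open_diagramE => /and4P[_ _ _ /eqP].
pose U o := [seq side_ranks (extend_side (upper d) (Some x) o)
              (extend_set (fixed_points d) false) | x <- closings k (upper d) (fixed_points d)].
pose L o := [seq side_ranks (extend_side (lower d) (Some x) o)
              (extend_set set0 false) | x <- closings k (lower d) set0].
set r := side_ranks (upper d) (fixed_points d).
set s := side_ranks (lower d) set0.
(* The subtraction is exact: a semi-arc being closed is counted in [h]. *)
have stateE st : closings_in d st -> state (extend d st) =
   (h + st.1.2 - isSome st.1.1,
    side_ranks (extend_side (upper d) st.1.1 st.1.2)
      (extend_set (fixed_points d) (kind st == ((0, 0), (0, 0)))),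
    side_ranks (extend_side (lower d) st.2.1 st.2.2) (extend_set set0 false)).
  move=> Sst; rewrite /state fixed_points_extend // extend_set0.
  by case/andP: Sst => /(card_semiarcs_extend st.1.2) <- _; rewrite addnK.
have SU x : x \in closings k (upper d) (fixed_points d) -> x \in semiarcs (upper d).
  by rewrite mem_filter mem_enum => /andP[].
have SL x : x \in closings k (lower d) set0 -> x \in semiarcs (lower d).
  by rewrite mem_filter mem_enum => /andP[].
have -> : [seq state (extend d st) | st <- steps k d] =
  [:: (h, set_first h r, s); (h.+1, r, s)]
  ++ [seq (h, t, s) | t <- U true] ++ [seq (h, r, t) | t <- L true]
  ++ [seq (h.-1, t, t') | t <- U false, t' <- L false].
  rewrite !map_cat map_allpairs; congr (_ ++ _ ++ _ ++ _).
  - rewrite /= !stateE //= addn0 subn0 addn1 subn0 side_ranks_fixed !side_ranks_open.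
    by [].
  - rewrite -!map_comp; apply/eq_in_map => x /SU Sx /=.
    by rewrite stateE /closings_in /= ?Sx // addn1 subn1 side_ranks_open.
  - rewrite -!map_comp; apply/eq_in_map => x /SL Sx /=.
    by rewrite stateE /closings_in /= ?Sx // addn0 subn0 side_ranks_open.
  - rewrite allpairs_mapl allpairs_mapr; apply/eq_in_allpairs => x y /SU Sx /SL Sy.
    by rewrite stateE /closings_in /= ?Sx ?Sy // addn0 subn1.
have PU o := perm_closings (upper d) (fixed_points d) o.
have PL o := perm_closings (lower d) set0 o.
rewrite -/h -/r in PU; rewrite hl -/s in PL.
rewrite /succession /state -/h -/r -/s.
set R := [seq replace_at r q.1 q.2 | q <- index_pairs h r] in PU.
set S := [seq replace_at s q.1 q.2 | q <- index_pairs h s] in PL.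
set bu := 0 < _ in PU *; set bl := 0 < _ in PL *.
have PP := perm_allpairs (fun t t' => (h.-1, t, t')) (PU false) (PL false).
apply: perm_trans (perm_cat (perm_refl _) (perm_cat (perm_map _ (PU true))
   (perm_cat (perm_map _ (PL true)) PP))) _.
(* A closer chooses independently above and below; distributing the product gives the four families
   of closers, up to order. *)
have EA : perm_eq [seq (h.-1, t, t') | t <- (if bu then [:: decr r] else [::]) ++ R,
     t' <- (if bl then [:: decr s] else [::]) ++ S]
  ((if bu && bl then [:: (h.-1, decr r, decr s)] else [::])
  ++ (if bu then [seq (h.-1, decr r, t) | t <- S] else [::])
  ++ (if bl then [seq (h.-1, t, decr s) | t <- R] else [::])
  ++ [seq (h.-1, t, t') | t <- R, t' <- S]).
  rewrite allpairs_cat catA; apply: perm_cat.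
    by case: (bu); case: (bl); rewrite /= ?cats0.
  rewrite perm_allpairs_catr; apply: perm_cat => //.
  by case: (bl); [rewrite allpairs1r | rewrite allpairs0r].
rewrite !map_cat -!catA perm_cat2l.
have -> : [seq (h, replace_at r p.1 p.2, s) | p <- index_pairs h r] = [seq (h, t, s) | t <- R].
  by rewrite -map_comp.
have -> : [seq (h, r, replace_at s p.1 p.2) | p <- index_pairs h s] = [seq (h, r, t) | t <- S].
  by rewrite -map_comp.
have -> : [seq (h.-1, decr r, replace_at s p.1 p.2) | p <- index_pairs h s] =
   [seq (h.-1, decr r, t) | t <- S] by rewrite -map_comp.
have -> : [seq (h.-1, replace_at r p.1 p.2, decr s) | p <- index_pairs h r] =
   [seq (h.-1, t, decr s) | t <- R] by rewrite -map_comp.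
have -> : [seq (h.-1, replace_at r p.1 p.2, replace_at s q.1 q.2)
             | p <- index_pairs h r, q <- index_pairs h s] =
   [seq (h.-1, t, t') | t <- R, t' <- S] by rewrite allpairs_mapl allpairs_mapr.
rewrite (fun_if (map _)) (fun_if (map _)) /=.
by rewrite !perm_cat2l -map_cat; exact: EA.
Qed.

(** The count alone would not carry the induction: the number of children depends on the label, so
    the multiset of labels is followed. *)
Lemma perm_Sigma_state n :
  perm_eq [seq state d | d <- enum (Sigma k n)]
          (tree_level (@succession k) (root_label k) n).
Proof.
elim: n => [|n IHn].
  have emptyA (A : {set arc 0}) : A = set0 by apply/setP=> -[[]].
  have emptyS (S : {set 'I_0}) : S = set0 by apply/setP=> -[].
  have eq_d (d : diagram 0) : d = ((set0, set0), (set0, set0)).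
    by case: d => [[A1 S1] [A2 S2]]; rewrite (emptyA A1) (emptyA A2) (emptyS S1) (emptyS S2).
  have -> : Sigma k 0 = [set ((set0, set0), (set0, set0))].
    apply/setP=> d; rewrite (eq_d d) [RHS]inE eqxx inE is_open_diagramE nonnestingE.
    rewrite cards0 eqxx andbT.
    apply/andP; split; first by apply/and3P; split;
      [apply/forall_inP | apply/forall_inP | apply/forallP] => [[[]]|[[]]|[]].
    apply/andP; split; rewrite /side_nonnesting (emptyS (futures _ _ _)) eqxx andbT /=;
      rewrite negb_or negb_and; apply/andP; split; try (apply/orP; right);
      by apply/existsPn => -[] // [].
  rewrite enum_set1 /= perm_sym; apply/permP => a /=; congr (_ + _); congr (nat_of_bool (a _)).
  rewrite /state /root_label cards0.
  have E : side_ranks ((set0, set0) : side 0) set0 = [tuple of nseq k.-1 0].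
    apply: val_inj => /=; apply: (@eq_from_nth _ 0); rewrite size_map size_iota ?size_nseq //.
    by move=> i ik; rewrite (nth_map 0) ?size_iota // nth_nseq ik (emptyS (futures _ _ _)) cards0.
  by rewrite (emptyS (fixed_points _)) /= E.
apply: perm_trans (perm_map _ (perm_Sigma_extend n k1)) _.
rewrite map_allpairs.
apply: perm_trans _ (perm_flatten (perm_map (@succession k) IHn)).
(* Only openness is kept, so that the induction can run over an arbitrary list of diagrams. *)
rewrite -map_comp; have: {subset enum (Sigma k n) <= @is_open_diagram n}.
  by move=> d; rewrite mem_enum inE => /andP[].
elim: (enum _) => // d ds IHds sub_ds.
rewrite allpairs_cons map_cons; apply: perm_cat.
  by apply: perm_steps; apply: sub_ds; rewrite inE eqxx.
by apply: IHds => e dse; apply: sub_ds; rewrite inE dse orbT.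
Qed.

End Labels.

Theorem theorem13 (k n : nat) (hk : 2 <= k) :
  #|Sigma k n| = size (tree_level (@succession k) (root_label k) n).
Proof.
by rewrite -(perm_size (perm_Sigma_state hk n)) size_map -cardE.
Qed.
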